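(* Assume relatively complete recourse and the finite-first-moment condition (both stated in the context). Let $$Q(\bm x,\bm\xi)=\min_{\bm y}\{\bm z^T\bm y:\ A(\bm\xi)\bm x+B\bm y\ge\bm b(\bm\xi),\ \bm y\in\mathbb R^m_+\},$$ with $A(\bm\xi)=A_0+\sum_{i=1}^m\xi_iA_i$ and $\bm b(\bm\xi)=\bm b_0+\sum_{i=1}^m\xi_i\bm b_i$, and suppose that the set $\mathcal E$ of extreme points of the polyhedron $\mathcal P=\{\bm p\in\mathbb R^k_+:B^T\bm p\le\bm z\}$ is known. Then the distributionally robust problem $$\min_{\bm x\in\mathcal X}\ \Big\{\bm c^T\bm x+\sup_{\mathbb F\in\mathcal F_N}\mathbb E_{\mathbb F}[Q(\bm x,\bm\xi)]\Big\}$$ over the 1-Wasserstein ball $\mathcal F_N$ is equivalent to the second-order conic program $$\begin{aligned}\min_{\bm x\in\mathcal X,\lambda,\bm s}\ &\bm c^T\bm x+\lambda\epsilon_N+\frac1N\sum_{i=1}^Ns_i\\ \text{s.t. }& s_i\ge(C\bm p)^T\widehat{\bm\xi}^i+\bm p^T(\bm b_0-A_0\bm x),\\ &\lambda\ge\|C\bm p\|_2,\qquad\forall i\in\{1,\dots,N\},\ \forall\bm p\in\mathcal E,\end{aligned}$$ where $C=C(\bm x)=[\bm b_1-A_1\bm x,\dots,\bm b_m-A_m\bm x]^T\in\mathbb R^{m\times k}$.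
   Context: Data: $\mathcal X\subset\mathbb R^n$ is a compact set of first-stage decisions, $\bm c\in\mathbb R^n$, $B\in\mathbb R^{k\times m}$, $\bm z\in\mathbb R^m$, $A_0,\dots,A_m\in\mathbb R^{k\times n}$, $\bm b_0,\dots,\bm b_m\in\mathbb R^k$. The random vector $\bm\xi\in\mathbb R^m$ takes values in a support set $\Xi\subseteq\mathbb R^m$, where $(\Xi,d)$ with $d(\bm\xi^1,\bm\xi^2)=\|\bm\xi^1-\bm\xi^2\|_2$ is a Polish metric space. Samples $\widehat{\bm\xi}^1,\dots,\widehat{\bm\xi}^N\in\Xi$ are given, and $\mathbb F_N=\frac1N\sum_{i=1}^N\delta_{\widehat{\bm\xi}^i}$ is the empirical distribution. $\mathcal M(\Xi)$ is the set of probability distributions supported on $\Xi$. Finite-first-moment condition: every $\mathbb F\in\mathcal M(\Xi)$ satisfies $\int_\Xi\|\bm\xi\|_2\,\mathbb F(\mathrm d\bm\xi)<\infty$ (i.e. $\mathcal M(\Xi)$ is restricted to such distributions). The 1-Wasserstein metric is $W^1(\mathbb F_1,\mathbb F_2)=\inf_K\int_{\Xi^2}\|\bm\xi^1-\bm\xi^2\|_2\,K(\mathrm d\bm\xi^1,\mathrm d\bm\xi^2)$, the infimum being over joint distributions $K$ on $\Xi^2$ with marginals $\mathbb F_1$ and $\mathbb F_2$. The 1-Wasserstein ball is $\mathcal F_N=\{\mathbb F\in\mathcal M(\Xi):W^1(\mathbb F_N,\mathbb F)\le\epsilon_N\}$ with radius $\epsilon_N>0$. Relatively complete recourse: the second-stage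 minimization problem defining $Q(\bm x,\bm\xi)$ is feasible for every $\bm x\in\mathcal X$ and every $\bm\xi$. Two minimization problems involving $\bm x$ are called equivalent if they have the same optimal value and the same optimal first-stage decisions $\bm x$ (after minimizing over the auxiliary variables).
   Formalization: The support set Ξ is additionally assumed unbounded in every direction (each unit vector is a limit of directions of points of Ξ going to infinity, e.g. Ξ=R^m); for arbitrary Polish Ξ, e.g. a single point, the equivalence fails. *)

(* Defs.v *)
(* MathComp / MathComp-Analysis. *)
From HB Require Import structures.
From mathcomp Require Import all_boot all_order all_algebra.
From mathcomp Require Import all_classical all_reals all_analysis.

Set Implicit Arguments.
Unset Strict Implicit.
Unset Printing Implicit Defensive.

Import Order.TTheory GRing.Theory Num.Theory.
Import numFieldNormedType.Exports.

Local Open Scope classical_set_scope.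
Local Open Scope ring_scope.

(* The library norm of a matrix is the sup norm, hence the explicit Euclidean
   norm below. *)
Definition dot (R : realType) (d : nat) (u v : 'cV[R]_d) : R :=
  \sum_(i < d) u i 0 * v i 0.

Definition enorm (R : realType) (d : nat) (v : 'cV[R]_d) : R :=
  Num.sqrt (\sum_(i < d) v i 0 ^+ 2).

Definition lev (R : realType) (d : nat) (u v : 'cV[R]_d) : Prop :=
  forall i, u i 0 <= v i 0.

Definition polish_metric (R : realType) (m : nat) (Xi : set 'cV[R]_m) : Prop :=
  (forall u : nat -> 'cV[R]_m, (forall i, Xi (u i)) ->
     (forall e, 0 < e -> exists M, forall i j,
        (M <= i)%N -> (M <= j)%N -> enorm (u i - u j) < e) ->
     exists2 l, Xi l & (fun i => enorm (u i - l)) @ \oo --> (0 : R)) /\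
  (exists D : set 'cV[R]_m, [/\ countable D, D `<=` Xi &
     forall x e, Xi x -> 0 < e -> exists2 y, D y & enorm (x - y) < e]).

(* Every unit vector is a limit of directions of points of Xi that escape to
   infinity; for instance Xi = R^m. Without such a condition the constraint
   lambda >= |C p| is only sufficient: for Xi a single point the Wasserstein
   ball is one Dirac mass and its radius does not enter the robust problem. *)
Definition unbounded_in_every_direction (R : realType) (m : nat)
    (Xi : set 'cV[R]_m) : Prop :=
  forall (v : 'cV[R]_m) (M delta : R), enorm v = 1 -> 0 < M -> 0 < delta ->
    exists xi, [/\ Xi xi, M < enorm xi & enorm ((enorm xi)^-1 *: xi - v) < delta].

Lemma unbounded_in_every_direction_setT (R : realType) (m : nat) :
  unbounded_in_every_direction [set: 'cV[R]_m].
Proof.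
move=> v M delta v1 M0 delta0; have M10 : 0 < M + 1 by rewrite addr_gt0.
have nv : enorm ((M + 1) *: v) = M + 1.
  rewrite /enorm (eq_bigr (fun i => (M + 1) ^+ 2 * v i 0 ^+ 2)).
    rewrite -mulr_sumr sqrtrM ?sqr_ge0// sqrtr_sqr ger0_norm ?ltW//.
    by rewrite -/(enorm v) v1 mulr1.
  by move=> i _; rewrite mxE exprMn.
exists ((M + 1) *: v); split => //; first by rewrite nv ltrDl.
rewrite nv scalerA mulVf ?gt_eqF// scale1r subrr /enorm big1 ?sqrtr0//.
by move=> i _; rewrite mxE expr0n.
Qed.

Definition extreme_points (R : realType) (k : nat) (P : set 'cV[R]_k) :
    set 'cV[R]_k :=
  [set p | P p /\ forall p1 p2 (t : R), P p1 -> P p2 -> 0 < t < 1 ->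
             p = t *: p1 + (1 - t) *: p2 -> p1 = p /\ p2 = p].

Section two_stage.
Context (R : realType) (n m k : nat).
Variables (A0 : 'M[R]_(k, n)) (A : 'I_m -> 'M[R]_(k, n)).
Variables (b0 : 'cV[R]_k) (b : 'I_m -> 'cV[R]_k).
Variables (B : 'M[R]_(k, m)) (z : 'cV[R]_m).

Definition techmx (xi : 'cV[R]_m) : 'M[R]_(k, n) :=
  A0 + \sum_(i < m) xi i 0 *: A i.

Definition rhs (xi : 'cV[R]_m) : 'cV[R]_k :=
  b0 + \sum_(i < m) xi i 0 *: b i.

Definition second_stage (x : 'cV[R]_n) (xi : 'cV[R]_m) : set 'cV[R]_m :=
  [set y | lev (rhs xi) (techmx xi *m x + B *m y) /\ lev 0 y].

(* Extended-real valued: -oo when the second-stage problem is unbounded, +oo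
   when it is infeasible. *)
Definition recourse (x : 'cV[R]_n) (xi : 'cV[R]_m) : \bar R :=
  ereal_inf [set (dot z y)%:E | y in second_stage x xi].

Definition relatively_complete_recourse (X : set 'cV[R]_n)
    (Xi : set 'cV[R]_m) : Prop :=
  forall x xi, X x -> Xi xi -> second_stage x xi !=set0.

Definition dual_polyhedron : set 'cV[R]_k :=
  [set p | lev 0 p /\ lev (B^T *m p) z].

Definition Cmx (x : 'cV[R]_n) : 'M[R]_(m, k) :=
  \matrix_(j < m) (b j - A j *m x)^T.

End two_stage.

Section wasserstein.
Context (R : realType) (m : nat).

Definition borel_space := g_sigma_algebraType (@open 'cV[R]_m).

Variable Xi : set borel_space.

(* Elements of M(Xi): probabilities on R^m that give mass one to Xi. *)
Definition finite_mean_on (F : probability borel_space R) : Prop :=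
  F Xi = 1%E /\ (\int[F]_(xi in Xi) (enorm (xi : 'cV[R]_m))%:E < +oo)%E.

Definition coupling (F1 F2 : {measure set borel_space -> \bar R})
    (K : probability (borel_space * borel_space)%type R) : Prop :=
  [/\ K (Xi `*` Xi) = 1%E,
      forall U, measurable U -> K (U `*` setT) = F1 U &
      forall U, measurable U -> K (setT `*` U) = F2 U].

Definition wasserstein1 (F1 F2 : {measure set borel_space -> \bar R}) : \bar R :=
  ereal_inf
    [set (\int[K]_(w in Xi `*` Xi) (enorm (w.1 - w.2 : 'cV[R]_m))%:E)%E
      | K in coupling F1 F2].

Definition wasserstein_ball (F0 : {measure set borel_space -> \bar R}) (eps : R) :
    set (probability borel_space R) :=
  [set F | finite_mean_on F /\ (wasserstein1 F0 F <= eps%:E)%E].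

End wasserstein.

Section empirical.
Context (R : realType) (m N : nat) (xihat : 'I_N -> borel_space R m).

Definition empirical (U : set (borel_space R m)) : \bar R :=
  ((N%:R^-1 : R)%:E * \sum_(i < N) \d_(xihat i) U)%E.

Let empirical0 : empirical set0 = 0%E.
Proof. by rewrite /empirical big1 ?mule0// => i _; rewrite measure0. Qed.

Let empirical_ge0 U : (0 <= empirical U)%E.
Proof. by rewrite mule_ge0 ?lee_fin ?invr_ge0// sume_ge0. Qed.

Let empirical_sigma_additive : semi_sigma_additive empirical.
Proof.
move=> U mU tU mUU; rewrite /empirical.
have -> : (fun j => \sum_(0 <= i < j)
      (N%:R^-1 : R)%:E * \sum_(l < N) \d_(xihat l) (U i))%E =
    (fun j => (N%:R^-1 : R)%:E *
      \sum_(l < N) \sum_(0 <= i < j) \d_(xihat l) (U i))%E.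
  apply/funext => j; rewrite exchange_big/= ge0_sume_distrr//.
  by move=> i _; rewrite sume_ge0.
apply: cvgeZl => //; apply: cvg_nnesum => [l _|l _].
  by apply: nearW => j; rewrite sume_ge0.
exact: measure_semi_sigma_additive.
Qed.

HB.instance Definition _ := isMeasure.Build _ _ _ empirical
  empirical0 empirical_ge0 empirical_sigma_additive.

End empirical.

Section problems.
Context (R : realType) (n m k N : nat).
Variables (c : 'cV[R]_n) (A0 : 'M[R]_(k, n)) (A : 'I_m -> 'M[R]_(k, n)).
Variables (b0 : 'cV[R]_k) (b : 'I_m -> 'cV[R]_k).
Variables (B : 'M[R]_(k, m)) (z : 'cV[R]_m).
Variables (xihat : 'I_N -> 'cV[R]_m) (eps : R).

Definition dro_objective (Xi : set 'cV[R]_m) (x : 'cV[R]_n) : \bar R :=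
  ((dot c x)%:E +
   ereal_sup [set \int[F]_(xi in Xi) recourse A0 A b0 b B z x xi
     | F in @wasserstein_ball R m Xi (empirical xihat) eps])%E.

(* A point of the conic program is (x, (lambda, s)). *)
Definition socp_objective (w : 'cV[R]_n * (R * 'cV[R]_N)) : \bar R :=
  (dot c w.1 + w.2.1 * eps + N%:R^-1 * \sum_(i < N) w.2.2 i 0)%:E.

Definition socp_feasible (X : set 'cV[R]_n) :
    set ('cV[R]_n * (R * 'cV[R]_N)) :=
  [set w | X w.1 /\
     forall i p, extreme_points (dual_polyhedron B z) p ->
       dot (Cmx A b w.1 *m p) (xihat i) + dot p (b0 - A0 *m w.1) <= (w.2.2 : 'cV[R]_N) i 0 /\
       enorm (Cmx A b w.1 *m p) <= w.2.1].

End problems.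

Definition argmin (R : realType) (T : Type) (D : set T) (f : T -> \bar R) : set T :=
  [set x | D x /\ f x = ereal_inf (f @` D)].

(* min f over X, against min g over D with auxiliary variables in Y. *)
Definition equivalent_problems (R : realType) (T Y : Type)
    (X : set T) (f : T -> \bar R) (D : set (T * Y)) (g : T * Y -> \bar R) : Prop :=
  ereal_inf (f @` X) = ereal_inf (g @` D) /\
  argmin X f =
  argmin [set x | exists y, D (x, y)]
    (fun x => ereal_inf [set g (x, y) | y in [set y | D (x, y)]]).

(* Main.v *)
Require Import Defs.
From HB Require Import structures.
From mathcomp Require Import all_boot all_order all_algebra.
From mathcomp Require Import all_classical all_reals all_analysis.
From mathcomp Require Import measurable_realfun ring lra zify.
Import Order.TTheory GRing.Theory Num.Theory.
Import numFieldNormedType.Exports.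
Local Open Scope classical_set_scope.
Local Open Scope ring_scope.

Set Implicit Arguments.
Unset Strict Implicit.
Unset Printing Implicit Defensive.

(** Fix a first-stage decision [x] and write [E] for the set of extreme points of
    the dual polyhedron [P].  By linear programming duality, [Q(x, xi)] is the
    supremum over [p] in [P] of an affine function of [xi], with gradient [C p].
    As [P] lies in an orthant it contains no line, so the supremum may be taken
    over the finite set [E] ([recourse_extreme_points]).  Hence [Q(x, .)]
    coincides on the support with a function [h], the maximum of finitely many
    affine ones, which is Lipschitz with constant [L], the largest of the norms
    [|C p|], and which grows at the rate [L] in the direction of the
    corresponding gradient.

    For such an [h], the supremum of the expectation over the Wasserstein ball is
    [eps * L] plus the average of [h] over the samples ([sup_wasserstein_ball]).
    It is not larger, because integrating [h u <= h v + L |u - v|] against a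
    coupling of the empirical distribution with another one bounds the difference
    of their expectations by [L] times the transport cost.  It is not smaller,
    because the support is unbounded in the direction of the steepest gradient: a
    small fraction of the mass can be moved very far, at a total cost of at most
    [eps], and in the limit [h] gains [L] per unit of cost.

    The conic program minimized over [lambda] and [s] has the same value, reached
    at [lambda = L] and [s_i = h xihat_i].  So both programs have the same
    objective as functions of [x].  If [P] is empty, the second stage,
    being feasible, is unbounded by Farkas' lemma; the conic program is left
    without constraints on [s], and both objectives are [-oo]. *)

(** * Euclidean geometry of column vectors *)

Section euclid.
Context {R : realType} {d : nat}.
Implicit Types (u v w : 'cV[R]_d) (t : R).

Lemma dotC u v : dot u v = dot v u.
Proof. by apply: eq_bigr => i _; rewrite mulrC. Qed.

Lemma dotDr u v w : dot u (v + w) = dot u v + dot u w.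
Proof. by rewrite -big_split; apply: eq_bigr => i _; rewrite mxE mulrDr. Qed.

Lemma dotZr t u v : dot u (t *: v) = t * dot u v.
Proof. by rewrite mulr_sumr; apply: eq_bigr => i _; rewrite mxE mulrCA. Qed.

Lemma dotNr u v : dot u (- v) = - dot u v.
Proof. by rewrite -scaleN1r dotZr mulN1r. Qed.

Lemma dotBr u v w : dot u (v - w) = dot u v - dot u w.
Proof. by rewrite dotDr dotNr. Qed.

Lemma dot0r u : dot u 0 = 0.
Proof. by rewrite -(scale0r 0) dotZr mul0r. Qed.

Lemma dotDl u v w : dot (u + v) w = dot u w + dot v w.
Proof. by rewrite dotC dotDr !(dotC w). Qed.

Lemma dotZl t u v : dot (t *: u) v = t * dot u v.
Proof. by rewrite dotC dotZr dotC. Qed.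

Lemma dotNl u v : dot (- u) v = - dot u v.
Proof. by rewrite dotC dotNr dotC. Qed.

Lemma dotBl u v w : dot (u - v) w = dot u w - dot v w.
Proof. by rewrite dotDl dotNl. Qed.

Lemma dot_delta u (i : 'I_d) : dot (delta_mx i 0) u = u i 0.
Proof.
rewrite /dot (bigD1 i)//= mxE !eqxx mul1r big1 ?addr0// => j ji.
by rewrite mxE (negPf ji) mul0r.
Qed.

Lemma dotvv_ge0 u : 0 <= dot u u.
Proof. by apply: sumr_ge0 => i _; rewrite -expr2 sqr_ge0. Qed.

Lemma enormE u : enorm u = Num.sqrt (dot u u).
Proof. by congr Num.sqrt; apply: eq_bigr => i _; rewrite expr2. Qed.

Lemma enorm_ge0 u : 0 <= enorm u.
Proof. exact: sqrtr_ge0. Qed.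

Lemma sqr_enorm u : enorm u ^+ 2 = dot u u.
Proof. by rewrite enormE sqr_sqrtr// dotvv_ge0. Qed.

Lemma enorm_eq0 u : enorm u = 0 -> u = 0.
Proof.
move=> u0; have /eqP : dot u u = 0 by rewrite -sqr_enorm u0 expr0n.
rewrite psumr_eq0; last by move=> i _; rewrite -expr2 sqr_ge0.
move=> /allP h; apply/matrixP => i j; rewrite ord1 mxE.
by have := h i (mem_index_enum i); rewrite mulf_eq0 orbb => /eqP.
Qed.

Lemma enorm0 : enorm (0 : 'cV[R]_d) = 0.
Proof. by rewrite enormE dot0r sqrtr0. Qed.

Lemma enormZ t u : enorm (t *: u) = `|t| * enorm u.
Proof.
by rewrite !enormE dotZl dotZr mulrA -expr2 sqrtrM ?sqr_ge0// sqrtr_sqr.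
Qed.

Lemma enormN u : enorm (- u) = enorm u.
Proof. by rewrite -scaleN1r enormZ normrN1 mul1r. Qed.

Lemma enormB u v : enorm (u - v) = enorm (v - u).
Proof. by rewrite -enormN opprB. Qed.

(** Cauchy-Schwarz, read off from the nonnegativity of the square of
    the vector [|v| u - |u| v]. *)
Lemma dot_le_enorm u v : dot u v <= enorm u * enorm v.
Proof.
have [u0|u0] := eqVneq (enorm u) 0.
  by rewrite (enorm_eq0 u0) dotC dot0r enorm0 mul0r.
have [v0|v0] := eqVneq (enorm v) 0.
  by rewrite (enorm_eq0 v0) dot0r enorm0 mulr0.
have a0 : 0 < enorm u by rewrite lt_neqAle eq_sym u0 enorm_ge0.
have b0 : 0 < enorm v by rewrite lt_neqAle eq_sym v0 enorm_ge0.
have := dotvv_ge0 (enorm v *: u - enorm u *: v).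
rewrite !(dotBl, dotBr) !(dotZl, dotZr) -!sqr_enorm (dotC v u).
set D := dot u v; have ab0 := mulr_gt0 a0 b0.
move: (enorm u) (enorm v) => a b in a0 b0 ab0 *.
have -> : b * (b * a ^+ 2) - b * (a * D) - (a * (b * D) - a * (a * b ^+ 2)) =
  (a * b) * (2 * (a * b - D)) by ring.
by rewrite pmulr_rge0// pmulr_rge0// subr_ge0.
Qed.

Lemma ler_enormD u v : enorm (u + v) <= enorm u + enorm v.
Proof.
rewrite -(@ler_pXn2r _ 2)//; try by rewrite nnegrE ?addr_ge0 ?enorm_ge0.
rewrite sqrrD !sqr_enorm dotDl !dotDr (dotC v u).
by have := dot_le_enorm u v; lra.
Qed.

Lemma ler_enormB u v w : enorm (u - w) <= enorm (u - v) + enorm (v - w).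
Proof. by rewrite (le_trans _ (ler_enormD _ _))// addrA subrK. Qed.

Lemma enorm_le_sum u : enorm u <= \sum_(i < d) `|u i 0|.
Proof.
have s0 : 0 <= \sum_(i < d) `|u i 0| by rewrite sumr_ge0.
rewrite -[leRHS]ger0_norm// -sqrtr_sqr ler_wsqrtr// expr2 mulr_suml.
apply: ler_sum => i _; rewrite -real_normK ?num_real// expr2.
by rewrite ler_wpM2l// (bigD1 i)//= lerDl sumr_ge0.
Qed.

End euclid.

(** * Farkas' lemma and linear programming duality *)

(** Bartl's induction on the number of inequalities.  If the last inequality
    [a j] is needed for the implication, there is [x] with [a j x = 1], with the
    other inequalities satisfied and [g x > 0]; replacing each vector [v] by
    [v - (v x) a j] reduces to the remaining inequalities. *)
Lemma farkas (R : realType) (d : nat) (J : eqType) (s : seq J)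
    (a : J -> 'cV[R]_d) (g : 'cV[R]_d) :
  uniq s ->
  (forall x, (forall j, j \in s -> dot (a j) x <= 0) -> dot g x <= 0) ->
  exists2 w : J -> R, forall j, 0 <= w j & g = \sum_(j <- s) w j *: a j.
Proof.
elim: s a g => [|j s IH] a g /=.
  move=> _ h; exists (fun=> 0) => //; rewrite big_nil.
  have /le_anti : dot g g <= 0 <= dot g g by rewrite h//= dotvv_ge0.
  by rewrite -sqr_enorm => /eqP; rewrite sqrf_eq0 => /eqP /enorm_eq0.
move=> /andP[js us] h.
have [|] := pselect (forall x, (forall i, i \in s -> dot (a i) x <= 0) ->
  dot g x <= 0).
  move=> /(IH a g us)[w w0 ->]; exists (fun i => if i == j then 0 else w i).
    by move=> i; case: ifP.
  rewrite big_cons eqxx scale0r add0r; apply: eq_big_seq => i si.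
  by case: eqP js => // <-; rewrite si.
move=> /existsNP[y0 /not_implyP[y0s /negP]]; rewrite -ltNge => gy0.
have ajy0 : 0 < dot (a j) y0.
  rewrite ltNge; apply/negP => ajy; move: gy0; apply/negP; rewrite -leNgt.
  by apply: h => i; rewrite inE => /orP[/eqP ->//|]; exact: y0s.
pose y := (dot (a j) y0)^-1 *: y0.
have yE v : dot v y = (dot (a j) y0)^-1 * dot v y0 by rewrite dotZr.
clearbody y.
have ys i : i \in s -> dot (a i) y <= 0.
  by move=> /y0s ?; rewrite yE pmulr_rle0// invr_gt0.
have gy : 0 < dot g y by rewrite yE mulr_gt0// invr_gt0.
have ajy : dot (a j) y = 1 by rewrite yE mulVf// gt_eqF.
pose red (v : 'cV[R]_d) : 'cV[R]_d := v - dot v y *: a j.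
have redE v x : dot (red v) x = dot v (x - dot (a j) x *: y).
by rewrite /red dotBl dotBr dotZl dotZr mulrC.
have [x hx|w w0 gE] := IH (red \o a) (red g) us.
  rewrite redE; apply: h => i; rewrite inE => /orP[/eqP ->|si].
    by rewrite dotBr dotZr ajy mulr1 subrr.
  by rewrite -redE hx.
exists (fun i => if i == j then dot g y - \sum_(i <- s) w i * dot (a i) y
                 else w i).
  move=> i; case: ifP => // _; rewrite subr_ge0.
  rewrite (le_trans _ (ltW gy))// big_seq sumr_le0// => l ls.
  by rewrite mulr_ge0_le0// ys.
rewrite big_cons eqxx.
rewrite (@eq_big_seq _ _ _ _ _ _ (fun i => w i *: (red (a i)) +
    (w i * dot (a i) y) *: a j)).
  rewrite big_split -gE /= -scaler_suml scalerBl /red.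
  by rewrite addrACA addNr addr0 addrC subrK.
move=> i si; rewrite /red; case: eqP js => [<-|_ _]; first by rewrite si.
by rewrite scalerBr scalerA subrK.
Qed.

Lemma dot_col_mx (R : realType) (d1 d2 : nat) (u1 v1 : 'cV[R]_d1)
    (u2 v2 : 'cV[R]_d2) :
  dot (col_mx u1 u2) (col_mx v1 v2) = dot u1 v1 + dot u2 v2.
Proof.
rewrite /dot big_split_ord; congr (_ + _); apply: eq_bigr => i _.
  by rewrite !col_mxEu.
by rewrite !col_mxEd.
Qed.

Section linear_programming.
Context {R : realType} {k m : nat}.
Variables (B : 'M[R]_(k, m)) (z : 'cV[R]_m).
Implicit Types (u p : 'cV[R]_k) (y : 'cV[R]_m).

Lemma dot_trmx p y : dot (B^T *m p) y = dot p (B *m y).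
Proof.
rewrite /dot; under eq_bigr do rewrite mxE mulr_suml.
under [RHS]eq_bigr do rewrite mxE mulr_sumr.
rewrite exchange_big; apply: eq_bigr => i _; apply: eq_bigr => j _.
by rewrite mxE mulrAC mulrC.
Qed.

Lemma trmx_mulE p (j : 'I_m) : (B^T *m p) j 0 = dot (col j B) p.
Proof. by rewrite mxE; apply: eq_bigr => i _; rewrite !mxE. Qed.

Lemma ler_dot (d : nat) (w v1 v2 : 'cV[R]_d) :
  lev 0 w -> lev v1 v2 -> dot v1 w <= dot v2 w.
Proof.
move=> w0 v12; apply: ler_sum => i _; apply: ler_wpM2r => //.
by have := w0 i; rewrite mxE.
Qed.

Lemma weak_duality u p y : lev u (B *m y) -> lev 0 y ->
  dual_polyhedron B z p -> dot u p <= dot z y.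
Proof.
move=> uy y0 [p0 pz]; rewrite (le_trans (ler_dot p0 uy))//.
by rewrite dotC -dot_trmx ler_dot.
Qed.

(** Farkas' lemma for the homogenized system [p >= 0], [t >= 0],
    [B^T p <= t z], of which [u p <= V t] is a consequence.  Where [t > 0] this
    is the hypothesis at [p / t]; where [t = 0] it holds because the primal
    feasible point [y0] bounds [u p] by [0].  So the dual polyhedron may be
    empty, in which case [V] is arbitrary. *)
Lemma strong_duality u (V : R) (y0 : 'cV[R]_m) :
  lev u (B *m y0) -> lev 0 y0 ->
  (forall p, dual_polyhedron B z p -> dot u p <= V) ->
  exists y, [/\ lev u (B *m y), lev 0 y & dot z y <= V].
Proof.
move=> uy0 y0_ge0 uV.
pose a (j : 'I_(k + 1) + 'I_m) : 'cV[R]_(k + 1) :=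
  match j with
  | inl i => - delta_mx i 0
  | inr j => col_mx (col j B) (- (z j 0)%:M)
  end.
pose g : 'cV[R]_(k + 1) := col_mx u (- V%:M).
have dot1 (x : R) (t : 'cV[R]_1) : dot (- x%:M) t = - (x * t 0 0).
  by rewrite dotNl /dot big_ord1 mxE eqxx mulr1n.
have [x hx|w w0 gE] := @farkas R (k + 1) _ (index_enum _) a g (index_enum_uniq _).
  have {}hx j : dot (a j) x <= 0 by apply: hx; rewrite mem_index_enum.
  rewrite -(vsubmxK x) in hx *; move: (usubmx x) (dsubmx x) hx => p t hx.
  have p0 : lev 0 p.
    move=> i; have := hx (inl (lshift 1 i)).
    by rewrite dotNl dot_delta col_mxEu mxE oppr_le0.
  have t0 : 0 <= t 0 0.
    have := hx (inl (rshift k 0)).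
    by rewrite dotNl dot_delta col_mxEd oppr_le0.
  have Bp j : dot (col j B) p <= z j 0 * t 0 0.
    by have := hx (inr j); rewrite dot_col_mx dot1 subr_le0.
  rewrite dot_col_mx dot1 subr_le0.
  have [t00|t_gt0] := eqVneq (t 0 0) 0.
    rewrite t00 mulr0 (le_trans (ler_dot p0 uy0))// dotC -dot_trmx.
    rewrite (le_trans (ler_dot (v2 := 0) y0_ge0 _)) ?(dotC 0) ?dot0r// => j.
    by rewrite trmx_mulE mxE (le_trans (Bp j))// t00 mulr0.
  have {}t0 : 0 < t 0 0 by rewrite lt_neqAle eq_sym t_gt0.
  have /uV : dual_polyhedron B z ((t 0 0)^-1 *: p).
    split=> j.
      by rewrite !mxE mulr_ge0 ?invr_ge0 ?(ltW t0)//; have := p0 j; rewrite mxE.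
    by rewrite trmx_mulE dotZr mulrC ler_pdivrMr.
  by rewrite dotZr mulrC ler_pdivrMr.
pose y : 'cV[R]_m := \col_j w (inr j).
have gi i : g i 0 = - w (inl i) + \sum_j y j 0 * a (inr j) i 0.
  rewrite {1}gE summxE big_sumType /=; congr (_ + _).
    rewrite (bigD1 i)//= !mxE !eqxx mulrN1 big1 ?addr0// => l li.
    by rewrite !mxE eq_sym (negPf li) oppr0 mulr0.
  by apply: eq_bigr => j _; rewrite !mxE.
exists y; split.
- move=> i; have := gi (lshift 1 i); rewrite col_mxEu => ->.
  rewrite mxE (eq_bigr (fun j => B i j * y j 0)).
    by rewrite gerDr oppr_le0.
  by move=> j _; rewrite col_mxEu mulrC mxE.
- by move=> j; rewrite !mxE.
- have := gi (rshift k 0); rewrite col_mxEd !mxE eqxx mulr1n.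
  rewrite (eq_bigr (fun j => - (z j 0 * y j 0))).
    rewrite sumrN -/(dot z y).
    by have := w0 (inl (rshift k 0)); lra.
  by move=> j _; rewrite col_mxEd !mxE eqxx mulr1n mulrN mulrC.
Qed.

End linear_programming.

(** * Extreme points of polyhedra *)

Definition polyhedron (R : realType) (d : nat) (J : finType)
    (a : J -> 'cV[R]_d) (c : J -> R) : set 'cV[R]_d :=
  [set p | forall j, dot (a j) p <= c j].

Section polyhedra.
Context {R : realType} {d : nat} {J : finType}.
Variables (a : J -> 'cV[R]_d) (c : J -> R).
Let P := polyhedron a c.
Implicit Types (p q v u : 'cV[R]_d).

(** The face of the polyhedron on which [p] lies is determined by this set. *)
Definition active p : {set J} := [set j | dot (a j) p == c j].

(** The ratio test of the simplex method: [t] is the least of the ratios at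
    which the ray from [p] meets the hyperplane of a constraint. *)
Lemma ratio_test p v : P p ->
    (forall j, j \in active p -> dot (a j) v = 0) ->
    (exists j, 0 < dot (a j) v) ->
  exists t, [/\ 0 < t, P (p + t *: v) & active p \proper active (p + t *: v)].
Proof.
move=> Pp v0 [j0 vj0]; pose r j := (c j - dot (a j) p) / dot (a j) v.
case: (@arg_minP _ _ _ j0 (fun j => 0 < dot (a j) v) r vj0) => j vj rmin.
have jp : j \notin active p by apply/negP => /v0 vj'; rewrite vj' ltxx in vj.
have slack : 0 < c j - dot (a j) p.
  rewrite subr_gt0 lt_neqAle Pp andbT.
  by move: jp; rewrite inE.
exists (r j); split; first by rewrite divr_gt0.
  move=> l; rewrite dotDr dotZr -lerBrDl.
  have [vl|vl] := ltP 0 (dot (a l) v).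
    by rewrite -ler_pdivlMr// rmin.
  rewrite (@le_trans _ _ 0) ?subr_ge0 ?Pp// mulr_ge0_le0//.
  by rewrite ltW// divr_gt0.
apply/properP; split.
  apply/fintype.subsetP => l lp; rewrite inE dotDr dotZr v0// mulr0 addr0.
  by rewrite inE in lp.
by exists j => //; rewrite inE dotDr dotZr divfK ?lt0r_neq0// addrC subrK.
Qed.

(** If [q] satisfies with equality the constraints active at [p], the segment
    from [q] to [p] can be prolonged beyond [p] inside the polyhedron; then [p]
    is interior to a segment, unless [p = q]. *)
Lemma extreme_active_inj p q : extreme_points P p -> P q ->
  active p \subset active q -> p = q.
Proof.
move=> [Pp ext] Pq /fintype.subsetP pq.
have v0 j : j \in active p -> dot (a j) (p - q) = 0.
  move=> jp; rewrite dotBr.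
  by move: (jp) (pq _ jp); rewrite !inE => /eqP -> /eqP ->; rewrite subrr.
have [t [t0 Pt]] : exists t, 0 < t /\ P (p + t *: (p - q)).
  have [/(ratio_test Pp v0)[t [t0 Pt _]]|/forallNP v_le0] :=
    pselect (exists j, 0 < dot (a j) (p - q)); first by exists t.
  exists 1; split=> // j; rewrite scale1r dotDr -[leRHS]addr0 lerD ?Pp//.
  by rewrite leNgt; apply/negP/v_le0.
have t1 : 0 < 1 + t by rewrite addr_gt0.
have [||_ ->//] := ext _ _ (1 + t)^-1 Pt Pq.
  by rewrite invr_gt0 t1/= invf_lt1// ltrDl.
have -> : 1 - (1 + t)^-1 = (1 + t)^-1 * t by field; rewrite gt_eqF.
rewrite -scalerA -scalerDr scalerBr -addrA subrK -{2}[p]scale1r -scalerDl.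
by rewrite scalerA mulVf ?gt_eqF// scale1r.
Qed.

(** An extreme point is determined by its active set, and there are finitely many
    active sets. *)
Lemma finite_extreme_points : exists s : seq 'cV[R]_d,
  forall p, extreme_points P p <-> p \in s.
Proof.
pose f (S : {set J}) : option 'cV[R]_d :=
  if pselect (exists p, extreme_points P p /\ active p = S) is left ex
  then Some (projT1 (cid ex)) else None.
have fE S p : f S = Some p -> extreme_points P p /\ active p = S.
  by rewrite /f; case: pselect => // ex [<-]; case: cid.
exists (pmap f (enum {set J})) => p; split.
  move=> ext; rewrite mem_pmap; apply/mapP; exists (active p).
    by rewrite mem_enum.
  have : f (active p) <> None by rewrite /f; case: pselect => // -[]; exists p.
  case E : (f (active p)) => [q|]// _.
  have [qext qp] := fE _ _ E; congr Some.
  by apply: extreme_active_inj => //; [case: qext|rewrite qp].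
by rewrite mem_pmap => /mapP[S _ /esym /fE[]].
Qed.

Hypothesis pointed : forall v, v != 0 -> exists j, dot (a j) v != 0.

(** A point that is not extreme can slide along some line on which its active
    constraints stay active; of the two directions, one does not decrease [u]
    and leaves the polyhedron, where a further constraint becomes active. *)
Lemma extreme_point_dominates u (V : R) p :
    (forall q, P q -> dot u q <= V) -> P p ->
  exists e, extreme_points P e /\ dot u p <= dot u e.
Proof.
move=> uV; have [n] := ubnP (#|J| - #|active p|)%N.
elim: n p => // n IH p pn Pp.
have [ext|next] := pselect (extreme_points P p); first by exists p.
(* [p] is inside a segment from [p1] to [p2]; a constraint active at [p] is
   active at both ends, because it is a weighted mean of their slacks. *)
have [v [v_neq0 v0]] : exists v, v != 0 /\
    forall j, j \in active p -> dot (a j) v = 0.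
  have /existsNP[p1 /existsNP[p2 /existsNP[t]]] : ~ forall p1 p2 t, P p1 ->
      P p2 -> 0 < t < 1 -> p = t *: p1 + (1 - t) *: p2 -> p1 = p /\ p2 = p.
    by move=> ?; apply: next.
  move=> /not_implyP[Pp1 /not_implyP[Pp2 /not_implyP[/andP[t0 t1]]]].
  move=> /not_implyP[pE ne]; exists (p1 - p2); split.
    apply/negP; rewrite subr_eq0 => /eqP p12; apply: ne.
    by rewrite pE p12 -scalerDl addrC subrK scale1r.
  move=> j; rewrite inE dotBr => /eqP; rewrite {1}pE dotDr !dotZr.
  move: (Pp1 j) (Pp2 j); move: (dot _ p1) (dot _ p2) => x1 x2 h1 h2 e.
  have : t * (c j - x1) + (1 - t) * (c j - x2) = 0 by rewrite -e; ring.
  move=> /eqP; rewrite paddr_eq0 ?mulr_ge0 ?subr_ge0// ?(ltW t0) ?(ltW t1)//.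
  rewrite !mulf_eq0 !subr_eq0 (gt_eqF t0) (gt_eqF t1) /=.
  by move=> /andP[/eqP <- /eqP <-]; rewrite subrr.
have {v v_neq0 v0} [v [uv v0 vj]] : exists v, [/\ 0 <= dot u v,
    forall j, j \in active p -> dot (a j) v = 0 & exists j, 0 < dot (a j) v].
  have [uv0|uv] := eqVneq (dot u v) 0.
    have [j] := pointed v_neq0; rewrite neq_lt => /orP[vj|vj].
      exists (- v); rewrite dotNr uv0 oppr0; split=> //.
        by move=> l /v0 vl; rewrite dotNr vl oppr0.
      by exists j; rewrite dotNr oppr_gt0.
    by exists v; rewrite uv0; split=> //; exists j.
  wlog uv_gt0 : v v0 uv {v_neq0} / 0 < dot u v.
    move=> wl; move: (uv); rewrite neq_lt => /orP[uv0|]; last exact: wl.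
    apply: (wl (- v)) => [j /v0 vj| |]; rewrite dotNr ?vj ?oppr0//.
      by rewrite oppr_eq0.
    by rewrite oppr_gt0.
  exists v; split => //; first exact: ltW.
  apply: contrapT => /forallNP v_le0.
  pose t := (V - dot u p + 1) / dot u v.
  have Vp : 0 < V - dot u p + 1 by have := uV _ Pp; lra.
  have /uV : P (p + t *: v).
    move=> j; rewrite dotDr dotZr -[leRHS]addr0 lerD ?Pp// mulr_ge0_le0//.
      by rewrite divr_ge0// ltW.
    by rewrite leNgt; apply/negP/v_le0.
  by rewrite dotDr dotZr divfK//; lra.
have [t [t0 Pt pt]] := ratio_test Pp v0 vj.
have [|e [ext ue]] := IH _ _ Pt.
  have := proper_card pt; have := max_card (active (p + t *: v)).
  by move: pn; move: #|_| #|_| #|_| => x1 x2 x3; lia.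
exists e; split=> //; rewrite (le_trans _ ue)// dotDr dotZr lerDl.
by rewrite mulr_ge0// ltW.
Qed.

End polyhedra.

(** * Borel sets and measurable functions of the Euclidean space *)

Section borel.
Context {R : realType} {m : nat}.
Local Notation borel := (borel_space R m).

Lemma open_borel (U : set 'cV[R]_m) : open U -> measurable (U : set borel).
Proof. exact: sub_sigma_algebra. Qed.

Lemma closed_borel (U : set 'cV[R]_m) : closed U -> measurable (U : set borel).
Proof. by move/closed_openC/open_borel/measurableC; rewrite setCK. Qed.

Lemma continuous_borel (f : 'cV[R]_m -> R) :
  continuous f -> measurable_fun [set: borel] f.
Proof.
move=> /continuousP cf; apply: (measurability _ (RGenOpens.measurableE R)).
move=> _ [_ [a [b ->] <-]]; rewrite setTI; apply: open_borel.
exact/cf/interval_open.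
Qed.

Lemma measurable_coord (i : 'I_m) :
  measurable_fun [set: borel] (fun x : borel => (x : 'cV[R]_m) i 0).
Proof. by apply: continuous_borel; exact: coord_continuous. Qed.

Lemma measurable_dot (a : 'cV[R]_m) :
  measurable_fun [set: borel] (fun x : borel => dot a x).
Proof.
by apply: measurable_sum => i; apply: measurable_funM => //;
  exact: measurable_coord.
Qed.

Lemma measurable_sqrt : measurable_fun [set: R] (@Num.sqrt R).
Proof. by apply: continuous_measurable_fun; exact: sqrt_continuous. Qed.

Lemma measurable_enorm :
  measurable_fun [set: borel] (fun x : borel => enorm (x : 'cV[R]_m)).
Proof.
apply: (measurableT_comp measurable_sqrt).
by apply: measurable_sum => i; apply: measurable_funX; exact: measurable_coord.
Qed.

(** The two factors have Borel sigma-algebras but their product carries the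
    product one, for which continuity does not give measurability at once; the
    coordinates do. *)
Lemma measurable_dist : measurable_fun [set: borel * borel]
  (fun w : borel * borel => enorm (w.1 - w.2 : 'cV[R]_m)).
Proof.
apply: (measurableT_comp measurable_sqrt).
apply: measurable_sum => i; apply: measurable_funX.
rewrite (_ : (fun _ => _) = (fun w : borel * borel =>
  (w.1 : 'cV[R]_m) i 0 - (w.2 : 'cV[R]_m) i 0)); last first.
  by apply/funext => w; rewrite !mxE.
by apply: measurable_funB; exact: (measurableT_comp (measurable_coord i)).
Qed.

(** A complete subset is closed: a point of the closure is the limit of a Cauchy
    sequence of the set.  The topology is given by the sup norm, so its balls
    are compared with Euclidean ones. *)
Lemma polish_metric_closed (Xi : set 'cV[R]_m) : polish_metric Xi -> closed Xi.
Proof.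
move=> [cauchy _] x xXi.
have near (e : R) : 0 < e -> exists y, Xi y /\ enorm (y - x) < e.
  move=> e0; have r0 : 0 < e / m.+1%:R by rewrite divr_gt0.
  have [y [Xiy xy]] := xXi _ (nbhsx_ballx x _ r0).
  exists y; split=> //; rewrite enormB (le_lt_trans (enorm_le_sum _))//.
  apply: (@le_lt_trans _ _ (\sum_(i < m) e / m.+1%:R)).
    by apply: ler_sum => i _; have := xy.2 i 0; rewrite !mxE => /ltW.
  rewrite sumr_const card_ord -[ltLHS]mulr_natr mulrAC ltr_pdivrMr//.
  by rewrite ltr_pM2l// ltr_nat.
have inv0 i : (0 : R) < i.+1%:R^-1 by rewrite invr_gt0.
pose u i := projT1 (cid (near _ (inv0 i))).
have uP i : Xi (u i) /\ enorm (u i - x) < i.+1%:R^-1.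
  by rewrite /u; case: cid.
have small (e : R) : 0 < e -> exists M, forall i, (M <= i)%N ->
    enorm (u i - x) < e.
  move=> e0; exists (Num.truncn e^-1) => i Mi.
  rewrite (lt_le_trans (uP i).2)// -[leRHS]invrK lef_pV2 ?posrE ?invr_gt0//.
  by rewrite (le_trans (ltW (truncnS_gt _)))// ler_nat.
have [|l Xil ul] := cauchy u (fun i => (uP i).1).
  move=> e e0; have [|M uM] := small (e / 2); first by rewrite divr_gt0.
  exists M => i j Mi Mj; rewrite (le_lt_trans (ler_enormB _ x _))//.
  by rewrite [ltRHS]splitr ltrD ?uM// enormB uM.
suff -> : x = l by [].
apply/eqP; rewrite -subr_eq0; apply/eqP/enorm_eq0/le_anti.
rewrite enorm_ge0 andbT; apply/ler_addgt0Pr => e e0; rewrite add0r.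
have e20 : 0 < e / 2 by rewrite divr_gt0.
have [M uM] := small _ e20.
have /cvgrPdist_lt/(_ _ e20)[M' _ uM'] := ul.
have := uM _ (leq_maxl M M'); have := uM' _ (leq_maxr M M').
rewrite /= sub0r normrN ger0_norm ?enorm_ge0// => h1 h2.
rewrite (le_trans (ler_enormB _ (u (maxn M M')) _))//.
by rewrite [leRHS]splitr lerD// ltW// enormB.
Qed.

End borel.

(** * Integrals with respect to discrete measures *)

Section discrete.
Context {d : measure_display} {T : measurableType d} {R : realType}.
Context {J : finType}.
Variables (w : J -> {nonneg R}) (x : J -> T).

(** Finite sums of measures are indexed by natural numbers, hence the
    enumeration of [J] and the zero measure beyond it. *)
Let atom (i : nat) : {measure set T -> \bar R} :=
  oapp (fun i : 'I_#|J| => mscale (w (enum_val i)) \d_(x (enum_val i)) :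
          {measure set T -> \bar R}) mzero (insub i).

Let big_atom (F : {measure set T -> \bar R} -> \bar R) :
  (\sum_(i < #|J|) F (atom i) =
   \sum_j F (mscale (w j) \d_(x j) : {measure set T -> \bar R}))%E.
Proof.
rewrite [RHS](reindex_onto enum_val enum_rank) => [|j _]; last exact: enum_rankK.
rewrite (eq_bigl xpredT) => [|i]; last by rewrite enum_valK eqxx.
by apply: eq_bigr => i _; rewrite /atom valK.
Qed.

Let discreteE (U : set T) :
  msum atom #|J| U = (\sum_j (w j)%:num%:E * \d_(x j) U)%E.
Proof. by rewrite /msum (big_atom (fun mu => mu U)). Qed.

(** Stated by the values of the measure, so that the measures of interest are
    recognized as discrete by a computation on sets only. *)
Lemma discrete_probability : \sum_j (w j)%:num = 1 ->
  exists P : probability T R,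
    forall U, P U = (\sum_j (w j)%:num%:E * \d_(x j) U)%E.
Proof.
move=> w1; pose mu : {measure set T -> \bar R} := msum atom #|J|.
have mu1 : mu setT = 1%E.
  rewrite [LHS]discreteE; under eq_bigr do rewrite diracT mule1.
  by rewrite sumEFin w1.
pose P : probability T R :=
  HB.pack (mu : set T -> \bar R) (Measure.class mu)
    (Measure_isProbability.Build _ _ _ mu mu1).
by exists P => U; rewrite -discreteE.
Qed.

Variable mu : {measure set T -> \bar R}.
Hypothesis muE : forall U, measurable U ->
  mu U = (\sum_j (w j)%:num%:E * \d_(x j) U)%E.
Variable f : T -> R.
Hypothesis mf : measurable_fun [set: T] f.

Let ge0_integral_discrete (g : T -> R) : measurable_fun [set: T] g ->
  (forall t, 0 <= g t) ->
  (\int[mu]_t (g t)%:E = (\sum_j (w j)%:num * g (x j))%:E)%E.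
Proof.
move=> mg g0; have mgE : measurable_fun [set: T] (EFin \o g).
  exact/measurable_EFinP.
rewrite (eq_measure_integral (msum atom #|J|)); last first.
  by move=> U mU _; rewrite muE//; exact/esym/discreteE.
rewrite ge0_integral_measure_sum//; last by move=> t _; rewrite lee_fin.
rewrite (big_atom (fun nu => \int[nu]_t (g t)%:E)%E) -sumEFin.
apply: eq_bigr => j _; rewrite ge0_integral_mscale//; last first.
  by move=> t _; rewrite lee_fin.
by rewrite integral_dirac//= diracT mul1e.
Qed.

Lemma integral_discrete :
  (\int[mu]_t (f t)%:E = (\sum_j (w j)%:num * f (x j))%:E)%E.
Proof.
have mp : measurable_fun setT (f^\+)%R by exact: measurable_funrpos.
have mn : measurable_fun setT (f^\-)%R by exact: measurable_funrneg.
rewrite integralE (_ : (fun t => (f t)%:E) = EFin \o f)// funerpos funerneg.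
rewrite !ge0_integral_discrete// -EFinB -sumrB; congr EFin.
by apply: eq_bigr => j _; rewrite -mulrBr -[in RHS](funrposBneg f).
Qed.

Lemma integrable_discrete : mu.-integrable [set: T] (EFin \o f).
Proof.
apply/integrableP; split; first exact/measurable_EFinP.
rewrite (eq_integral (fun t => `|f t|%:E)) => [|t _]; last by [].
rewrite ge0_integral_discrete ?ltry//.
exact: measurableT_comp.
Qed.

End discrete.

(** * Lipschitz functions over a Wasserstein ball *)

Section marginals.
Context {d1 d2 : measure_display} {S : measurableType d1}.
Context {T : measurableType d2} {R : realType}.

(** The change of variables formula, in the form that turns integrals against the
    marginals of a coupling into integrals against the coupling; integrability
    is assumed on the side of the marginal. *)
Lemma integral_marginal (K : {measure set S -> \bar R})
    (mu : {measure set T -> \bar R}) (phi : S -> T) (D : set T) (f : T -> R) :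
  measurable_fun [set: S] phi ->
  (forall U, measurable U -> mu U = K (phi @^-1` U)) ->
  measurable D -> measurable_fun [set: T] f -> mu.-integrable D (EFin \o f) ->
  K.-integrable (phi @^-1` D) (EFin \o f \o phi) /\
  (\int[mu]_(x in D) (f x)%:E = \int[K]_(s in phi @^-1` D) (f (phi s))%:E)%E.
Proof.
move=> mphi muK mD mf /integrableP[_ intf].
have mphiD : measurable (phi @^-1` D).
  by rewrite -[X in measurable X]setTI; exact: mphi.
have pushE (g : T -> \bar R) :
    (\int[mu]_(x in D) g x = \int[pushforward K phi]_(x in D) g x)%E.
  by apply: eq_measure_integral => U mU _; exact: muK.
have mfE : measurable_fun [set: T] (EFin \o f) by exact/measurable_EFinP.
have intK : K.-integrable (phi @^-1` D) (EFin \o f \o phi).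
  apply/integrableP; split.
    by apply: measurable_funTS; exact: measurableT_comp.
  move: intf; rewrite pushE ge0_integral_pushforward//.
  by apply: measurable_funTS; exact: measurableT_comp.
by split=> //; rewrite pushE (integral_pushforward mphi mfE intK mD).
Qed.

(** Needed to pass between the support, where the recourse function is known, and
    the whole space, where measures and marginals are handled. *)
Lemma integral_full (P : probability S R) (D E : set S) (f : S -> \bar R) :
  measurable D -> measurable E -> D `<=` E -> P D = 1%E ->
  P.-integrable E f -> (\int[P]_(x in E) f x = \int[P]_(x in D) f x)%E.
Proof.
move=> mD mE DE PD intf.
rewrite (negligible_integral (measurableC mD) mE intf); last first.
  by rewrite [LHS](probability_setC P mD) PD subee.
by rewrite setDE setCK setIC setIidl.
Qed.

End marginals.

Section lipschitz_over_ball.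
Context {R : realType} {m N : nat}.
Local Notation borel := (borel_space R m).
Variables (Xi : set borel) (xihat : 'I_N -> borel) (eps : R).
Hypotheses (mXi : measurable Xi) (N_gt0 : (0 < N)%N).
Hypotheses (xihat_Xi : forall i, Xi (xihat i)) (eps_gt0 : 0 < eps).

Definition average (f : 'I_N -> R) : R := N%:R^-1 * \sum_(i < N) f i.

Let NR_gt0 : 0 < N%:R :> R. Proof. by rewrite ltr0n. Qed.

Lemma ler_average (f g : 'I_N -> R) :
  (forall i, f i <= g i) -> average f <= average g.
Proof. by move=> fg; rewrite ler_wpM2l ?invr_ge0 ?ler0n// ler_sum. Qed.

Lemma averageD (f g : 'I_N -> R) :
  average (fun i => f i + g i) = average f + average g.
Proof. by rewrite /average big_split mulrDr. Qed.

Lemma average_cst (r : R) : average (fun=> r) = r.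
Proof.
rewrite /average sumr_const card_ord -[r *+ N]mulr_natl mulKf//.
by rewrite lt0r_neq0.
Qed.

Lemma average_ge0 (f : 'I_N -> R) : (forall i, 0 <= f i) -> 0 <= average f.
Proof. by move=> f0; rewrite mulr_ge0 ?invr_ge0 ?ler0n// sumr_ge0. Qed.

Let weight_ge0 : 0 <= N%:R^-1 :> R. Proof. by rewrite invr_ge0 ler0n. Qed.

Lemma empiricalE (U : set borel) :
  empirical xihat U = (\sum_i (NngNum weight_ge0)%:num%:E * \d_(xihat i) U)%E.
Proof.
by rewrite /empirical ge0_sume_distrr//= => i _; rewrite diracE lee_fin ler0n.
Qed.

Lemma integral_empirical (f : borel -> R) : measurable_fun [set: borel] f ->
  (\int[empirical xihat]_x (f x)%:E = (average (f \o xihat))%:E)%E.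
Proof.
move=> mf; rewrite (integral_discrete (fun U _ => empiricalE U) mf).
by rewrite /average mulr_sumr.
Qed.

Lemma integrable_empirical (f : borel -> R) : measurable_fun [set: borel] f ->
  (empirical xihat).-integrable [set: borel] (EFin \o f).
Proof. exact: (integrable_discrete (fun U _ => empiricalE U)). Qed.

Variables (h : 'cV[R]_m -> R) (L : R).
Hypothesis L_ge0 : 0 <= L.
Hypothesis mh : measurable_fun [set: borel] (h : borel -> R).
Hypothesis h_lip : forall x y, h x <= h y + L * enorm (x - y).

(** A Lipschitz function is dominated by an affine function of the norm. *)
Lemma lipschitz_integrable (F : probability borel R) :
  finite_mean_on Xi F -> F.-integrable Xi (EFin \o (h : borel -> R)).
Proof.
move=> [FXi Fmean].
have intn : F.-integrable Xi (fun x : borel => (enorm (x : 'cV[R]_m))%:E).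
  apply/integrableP; split.
    by apply: measurable_funTS; apply/measurable_EFinP; exact: measurable_enorm.
  rewrite (eq_integral (fun x : borel => (enorm (x : 'cV[R]_m))%:E))// => x _.
  by rewrite gee0_abs// lee_fin enorm_ge0.
pose g (x : borel) : \bar R := ((`|h 0|)%:E + L%:E * (enorm (x : 'cV[R]_m))%:E)%E.
have intg : F.-integrable Xi g.
  apply: integrableD => //; last exact: integrableZl.
  by apply: finite_measure_integrable_cst.
apply: (le_integrable mXi _ _ intg).
  by apply: measurable_funTS; exact/measurable_EFinP.
move=> x _; rewrite /g -EFinM -EFinD !abse_EFin lee_fin.
rewrite [leRHS]ger0_norm; last by rewrite addr_ge0// mulr_ge0// enorm_ge0.
have := h_lip x 0; have := h_lip 0 x; rewrite sub0r enormN subr0 => h1 h2.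
have := ler_norm (h 0); have := ler_norm (- h 0); rewrite normrN => h3 h4.
by rewrite ler_norml; apply/andP; split; lra.
Qed.

(** Integrate the Lipschitz inequality against a coupling.  The infimum in the
    Wasserstein metric need not be attained, so the coupling costs slightly more
    than [eps]. *)
Lemma ball_integral_le (F : probability borel R) :
  wasserstein_ball Xi (empirical xihat) eps F ->
  (\int[F]_(x in Xi) (h x)%:E <= (eps * L + average (h \o xihat))%:E)%E.
Proof.
move=> [Fmean W]; apply/lee_addgt0Pr => e e0.
have L1 : 0 < L + 1 by rewrite ltr_wpDl.
(* The excess cost is multiplied by [L], which may vanish. *)
pose e' := e / (L + 1).
have e'0 : 0 < e' by rewrite divr_gt0.
have [_ [K [KXi K1 K2] <-] cost] : exists2 y,
    [set (\int[K]_(w in Xi `*` Xi) (enorm (w.1 - w.2 : 'cV[R]_m))%:E)%E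
      | K in coupling Xi (empirical xihat) F] y & (y < (eps + e')%:E)%E.
  by apply: ereal_inf_lt; rewrite (le_lt_trans W)// lte_fin ltrDl.
have mXX : measurable (Xi `*` Xi) by exact: measurableX.
have intF := lipschitz_integrable Fmean.
have {}K2 U : measurable U -> F U = K (snd @^-1` U).
  by move=> mU; rewrite -K2// setTX.
have {}K1 U : measurable U -> empirical xihat U = K (fst @^-1` U).
  by move=> mU; rewrite -K1// setXT.
have [int2 ->] := integral_marginal measurable_snd K2 mXi mh intF.
have [int1 E1] := integral_marginal measurable_fst K1 measurableT mh
  (integrable_empirical mh).
rewrite preimage_setT in int1 E1; rewrite integral_empirical// in E1.
have m2 : measurable (snd @^-1` Xi : set (borel * borel)).
  by rewrite -[X in measurable X]setTI; exact: measurable_snd.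
rewrite (integral_full mXX m2 _ KXi int2); last by move=> w [].
rewrite (integral_full mXX measurableT _ KXi int1)// in E1.
pose dist (w : borel * borel) : \bar R := (enorm (w.1 - w.2 : 'cV[R]_m))%:E.
have intd : K.-integrable (Xi `*` Xi) dist.
  apply/integrableP; split.
    by apply: measurable_funTS; apply/measurable_EFinP; exact: measurable_dist.
  rewrite (eq_integral dist) => [|w _]; first by rewrite (lt_trans cost)// ltry.
  by rewrite gee0_abs// lee_fin enorm_ge0.
have intLd : K.-integrable (Xi `*` Xi) (fun w => (L%:E * dist w)%E).
  exact: integrableZl.
have int1' : K.-integrable (Xi `*` Xi) (EFin \o (h : borel -> R) \o fst).
  exact: integrableS int1.
apply: (@le_trans _ _ (\int[K]_(w in Xi `*` Xi)
    ((h w.1)%:E + L%:E * dist w))%E).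
  apply: le_integral => //.
  - by apply: integrableS int2 => // w [].
  - exact: integrableD.
  - by move=> w _; rewrite /= -EFinM -EFinD lee_fin enormB h_lip.
rewrite integralD// integralZl// -E1 [leRHS](_ : _ =
  (average (h \o xihat))%:E + (eps * L + e)%:E)%E; last first.
  by rewrite -!EFinD; congr EFin; ring.
rewrite leeD2l// (@le_trans _ _ (L%:E * (eps + e')%:E)%E)//.
  by rewrite lee_wpmul2l ?lee_fin// ltW.
rewrite -EFinM lee_fin mulrDr mulrC lerD2l /e' mulrA ler_pdivrMr//.
by rewrite mulrC ler_wpM2l ?(ltW e0)// lerDl.
Qed.

(** Moving the fraction [t] of every sample to the point [y] is a transport of
    cost [t] times the average distance from the samples to [y]. *)
Lemma ball_mixture (t : R) (y : 'cV[R]_m) : 0 <= t <= 1 -> Xi y ->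
    t * average (fun i => enorm (xihat i - y)) <= eps ->
  exists2 F, wasserstein_ball Xi (empirical xihat) eps F &
    (\int[F]_(x in Xi) (h x)%:E =
      ((1 - t) * average (h \o xihat) + t * h y)%:E)%E.
Proof.
move=> /andP[t0 t1] Xiy tcost.
(* Sample [i] is split into an atom [(i, false)], which stays, and an atom
   [(i, true)], which is moved to [y]. *)
have w_ge0 (j : 'I_N * bool) : 0 <= N%:R^-1 * (if j.2 then t else 1 - t).
  by rewrite mulr_ge0// ?invr_ge0 ?ler0n//; case: ifP; rewrite ?subr_ge0.
pose w j := NngNum (w_ge0 j).
pose dst (j : 'I_N * bool) : borel := if j.2 then y else xihat j.1.
have sumw (f : 'I_N * bool -> R) : \sum_j (w j)%:num * f j =
    (1 - t) * average (fun i => f (i, false)) +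
    t * average (fun i => f (i, true)).
  rewrite /= (eq_bigr (fun j : 'I_N * bool => N%:R^-1 *
    (if j.2 then t else 1 - t) * f (j.1, j.2))); last by case.
  rewrite -(pair_bigA _ (fun i b => N%:R^-1 * (if b then t else 1 - t) *
    f (i, b)))/= /average !mulr_sumr -big_split/=.
  by apply: eq_bigr => i _; rewrite big_bool /=; ring.
have w1 : \sum_j (w j)%:num = 1.
  rewrite (eq_bigr (fun j => (w j)%:num * 1)) => [|j _]; last by rewrite mulr1.
  by rewrite sumw /= (average_cst 1) !mulr1 subrK.
have [F FE] := discrete_probability dst w1.
have [K KE] := discrete_probability (fun j => (xihat j.1, dst j)) w1.
have FE' U : measurable U -> F U = (\sum_j (w j)%:num%:E * \d_(dst j) U)%E.
  by [].
have dstXi j : Xi (dst j) by rewrite /dst; case: ifP.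
have FXi : F Xi = 1%E.
  rewrite FE -[RHS](congr1 EFin w1) -sumEFin; apply: eq_bigr => j _.
  by rewrite diracE mem_set ?mule1.
have intXi (f : borel -> R) : measurable_fun [set: borel] f ->
    (\int[F]_(x in Xi) (f x)%:E = (\sum_j (w j)%:num * f (dst j))%:E)%E.
  move=> mf; rewrite -(integral_full mXi measurableT _ FXi)//.
    exact: integral_discrete.
  exact: (integrable_discrete FE').
exists F; last by rewrite intXi// sumw /= (average_cst (h y)).
split; first by split=> //; rewrite intXi ?ltry//; exact: measurable_enorm.
have KXi : K (Xi `*` Xi) = 1%E.
  rewrite KE -[RHS](congr1 EFin w1) -sumEFin; apply: eq_bigr => j _.
  by rewrite diracE mem_set ?mule1//; split => /=.
apply: (@le_trans _ _ (\int[K]_(w in Xi `*` Xi)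
    (enorm (w.1 - w.2 : 'cV[R]_m))%:E)%E).
  apply: ereal_inf_lbound; exists K => //; split=> // U mU.
    rewrite KE [RHS]empiricalE (eq_bigr (fun j => ((w j)%:num *
        (xihat j.1 \in U)%:R)%:E)); last first.
      by move=> j _; rewrite diracE EFinM in_setX /= in_setT andbT.
    rewrite sumEFin sumw /= -mulrDl subrK mul1r /average mulr_sumr -sumEFin.
    by apply: eq_bigr => i _; rewrite diracE EFinM.
  rewrite KE [RHS]FE; apply: eq_bigr => j _.
  by rewrite !diracE in_setX in_setT.
have KE' U : measurable U ->
    K U = (\sum_j (w j)%:num%:E * \d_(xihat j.1, dst j) U)%E by [].
rewrite -(integral_full _ measurableT _ KXi)//; last 2 first.
- exact: measurableX.
- exact: (integrable_discrete KE' measurable_dist).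
rewrite (integral_discrete KE' measurable_dist) sumw /=.
rewrite /average big1 ?mulr0 ?add0r ?lee_fin// => i _.
by rewrite subrr enorm0.
Qed.

Variables (a : 'cV[R]_m) (d0 : R).
Hypotheses (aL : enorm a = L) (h_ge : forall x, dot a x + d0 <= h x).
Hypothesis Xi_unbounded : unbounded_in_every_direction (Xi : set 'cV[R]_m).

(** When [L > 0], a point [y] of the support far away in the direction of [a] has
    [h y] of order [L |y|], and its average distance [D] from the samples is of
    order [|y|]; the fraction [eps / D] of the mass moved to [y] adds nearly
    [eps * L] to the expectation of [h]. *)
Lemma far_mixture (e : R) : 0 < e ->
  exists t y, [/\ 0 <= t <= 1, Xi y,
    t * average (fun i => enorm (xihat i - y)) <= eps &
    eps * L + average (h \o xihat) - e <=
      (1 - t) * average (h \o xihat) + t * h y].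
Proof.
move=> e0; set H := average (h \o xihat).
have [L0|L_neq0] := eqVneq L 0.
  exists 0, (xihat (Ordinal N_gt0)); rewrite lexx ler01 !mul0r (ltW eps_gt0).
  by split=> //; rewrite L0; lra.
have L_gt0 : 0 < L by rewrite lt_neqAle eq_sym L_neq0.
pose n0 := average (fun i => enorm (xihat i : 'cV[R]_m)).
have n0_ge0 : 0 <= n0 by apply: average_ge0 => i; exact: enorm_ge0.
(* [q] is the loss on the slope [L] that an error [e] allows; cutting it at [L]
   keeps [L - q] nonnegative, so that upper bounds on [D] can be used. *)
pose q := Num.min (e / eps) L.
have q0 : 0 < q by rewrite lt_min divr_gt0.
have qL : q <= L by rewrite ge_min lexx orbT.
have qe : eps * q <= e by rewrite mulrC -ler_pdivlMr// ge_min lexx.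
(* Beyond norm [r0], half of [q] absorbs the terms that do not grow; the other
   half pays for the error on the direction. *)
pose r0 := `|H - d0 + (L - q) * n0| * (2 / q).
have r0_ge0 : 0 <= r0 by rewrite mulr_ge0// divr_ge0// ltW.
have v1 : enorm (L^-1 *: a) = 1.
  by rewrite enormZ aL ger0_norm ?invr_ge0// mulVf.
have [||y [Xiy yM ydir]] := @Xi_unbounded _ (n0 + eps + r0) (q / (2 * L)) v1.
- by rewrite ltr_wpDr// ltr_wpDl.
- by rewrite divr_gt0// mulr_gt0.
pose r := enorm y; rewrite -/r in yM ydir.
have r_gt0 : 0 < r by apply: le_lt_trans yM; rewrite !addr_ge0// ltW.
pose D := average (fun i => enorm (xihat i - y)).
have D_le : D <= n0 + r.
  rewrite -[r in leRHS]average_cst -averageD; apply: ler_average => i.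
  by rewrite (le_trans (ler_enormD _ _))// enormN.
have D_ge : r <= D + n0.
  rewrite -[leLHS]average_cst -averageD; apply: ler_average => i.
  by have := ler_enormD (y - xihat i) (xihat i); rewrite subrK enormB.
have D_eps : eps <= D by lra.
have D_gt0 : 0 < D by rewrite (lt_le_trans eps_gt0).
have ay : r * (L - q / 2) <= dot a y.
  have : dot a (L^-1 *: a - r^-1 *: y) <= q / 2.
    rewrite (le_trans (dot_le_enorm _ _))// aL enormB.
    rewrite (le_trans (ler_wpM2l L_ge0 (ltW ydir)))//.
    by rewrite le_eqVlt; apply/orP; left; apply/eqP; field.
  rewrite dotBr !dotZr -sqr_enorm aL expr2 mulKf// lerBlDr -lerBlDl.
  by rewrite -(ler_pM2l r_gt0) mulVKf// gt_eqF.
have key : (L - q) * D <= h y - H.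
  have h1 : (L - q) * D <= (L - q) * (n0 + r) by rewrite ler_wpM2l// subr_ge0.
  have h2 := h_ge y.
  have h3 : H - d0 + (L - q) * n0 <= r * (q / 2).
    rewrite (le_trans (ler_norm _))// -ler_pdivrMr ?divr_gt0// invf_div.
    by rewrite (le_trans _ (ltW yM))// lerDr addr_ge0// ltW.
  move: h1; rewrite mulrDr => h1.
  have : r * (L - q / 2) = (L - q) * r + r * (q / 2) by field.
  by lra.
exists (eps / D), y; split=> //.
- by rewrite divr_ge0 ?(ltW eps_gt0) ?(ltW D_gt0)//= ler_pdivrMr// mul1r.
- by rewrite divfK// gt_eqF.
have : eps / D * ((L - q) * D) <= eps / D * (h y - H).
  by rewrite ler_wpM2l// divr_ge0// ltW.
have -> : eps / D * ((L - q) * D) = eps * L - eps * q.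
  by field; rewrite gt_eqF.
by rewrite mulrBl mul1r mulrBr; lra.
Qed.

(** The strong duality of Wasserstein balls, in the case where the regularization
    term is explicit. *)
Theorem sup_wasserstein_ball :
  ereal_sup [set (\int[F]_(x in Xi) (h x)%:E)%E
    | F in wasserstein_ball Xi (empirical xihat) eps] =
  (eps * L + average (h \o xihat))%:E.
Proof.
apply/le_anti/andP; split.
  by apply: ge_ereal_sup => _ [F FW <-]; exact: ball_integral_le.
apply/lee_addgt0Pr => e e0.
have [t [y [t01 Xiy tcost hy]]] := far_mixture e0.
have [F FW FE] := ball_mixture t01 Xiy tcost.
rewrite -leeBlDr// -EFinB (le_trans (y := (\int[F]_(x in Xi) (h x)%:E)%E))//.
  by rewrite FE lee_fin.
by apply: ereal_sup_ubound; exists F.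
Qed.

End lipschitz_over_ball.

(** * Maxima of finitely many functions *)

Section seqmax.
Context {R : realType} {T : eqType}.

Definition seqmax (f : T -> R) (p0 : T) (s : seq T) : R :=
  foldr (fun p r => Num.max (f p) r) (f p0) s.

Lemma le_seqmax (f : T -> R) (p0 : T) (s : seq T) (p : T) :
  p \in p0 :: s -> f p <= seqmax f p0 s.
Proof.
elim: s => [|q s IH] /=; first by rewrite inE => /eqP ->.
rewrite !inE le_max => /or3P[/eqP pp|/eqP ->|ps].
- by rewrite IH ?orbT// pp mem_head.
- by rewrite lexx.
- by rewrite IH ?orbT// inE ps orbT.
Qed.

Lemma seqmax_attained (f : T -> R) (p0 : T) (s : seq T) :
  exists2 p, p \in p0 :: s & seqmax f p0 s = f p.
Proof.
elim: s => [|q s [p ps IH]] /=; first by exists p0; rewrite ?mem_head.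
rewrite IH; case: leP => _; last by exists q; rewrite // !inE eqxx orbT.
by exists p => //; move: ps; rewrite !inE => /orP[->//|->]; rewrite !orbT.
Qed.

Lemma measurable_seqmax (d : measure_display) (S : measurableType d)
    (f : T -> S -> R) (p0 : T) (s : seq T) :
  (forall p, measurable_fun [set: S] (f p)) ->
  measurable_fun [set: S] (fun x => seqmax (f^~ x) p0 s).
Proof. by move=> mf; elim: s => //= q s IH; exact: measurable_maxr. Qed.

End seqmax.

(** * The recourse function *)

Section recourse_function.
Context {R : realType} {n m k : nat}.
Variables (A0 : 'M[R]_(k, n)) (A : 'I_m -> 'M[R]_(k, n)).
Variables (b0 : 'cV[R]_k) (b : 'I_m -> 'cV[R]_k).
Variables (B : 'M[R]_(k, m)) (z : 'cV[R]_m).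
Implicit Types (x : 'cV[R]_n) (xi y : 'cV[R]_m) (p : 'cV[R]_k).

Lemma dual_polyhedronE : dual_polyhedron B z =
  polyhedron (fun j : 'I_k + 'I_m =>
                match j with inl i => - delta_mx i 0 | inr i => col i B end)
             (fun j => match j with inl _ => 0 | inr i => z i 0 end).
Proof.
apply/seteqP; split=> [p [p0 Bp] [i|i]|p Pp].
- by have := p0 i; rewrite dotNl dot_delta oppr_le0 mxE.
- by rewrite -trmx_mulE.
- split=> i; first by have := Pp (inl i); rewrite dotNl dot_delta oppr_le0 mxE.
  by have := Pp (inr i); rewrite -trmx_mulE.
Qed.

(** A sequence instead of a finite set: the pieces of the recourse function are
    later combined by recursion along it. *)
Lemma finite_dual_extreme_points : exists s : seq 'cV[R]_k,
  forall p, extreme_points (dual_polyhedron B z) p <-> p \in s.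
Proof. by rewrite dual_polyhedronE; exact: finite_extreme_points. Qed.

(** The sign constraints make the dual polyhedron pointed, whatever [B] is. *)
Lemma dual_extreme_point_dominates (u : 'cV[R]_k) (V : R) p :
  (forall q, dual_polyhedron B z q -> dot u q <= V) -> dual_polyhedron B z p ->
  exists e, extreme_points (dual_polyhedron B z) e /\ dot u p <= dot u e.
Proof.
rewrite dual_polyhedronE => uV Pp; apply: (extreme_point_dominates _ uV Pp) => v v0.
have [i vi] : exists i, v i 0 != 0.
  apply: contrapT => /forallNP v_eq0; move/negP: v0; apply; apply/eqP.
  apply/matrixP => i j; rewrite ord1 mxE.
  by apply/eqP; rewrite -[_ == _]negbK; apply/negP/v_eq0.
by exists (inl i); rewrite dotNl dot_delta oppr_eq0.
Qed.

Definition slack_rhs x xi : 'cV[R]_k := rhs b0 b xi - techmx A0 A xi *m x.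

Definition affine_piece x p xi : R :=
  dot (Cmx A b x *m p) xi + dot p (b0 - A0 *m x).

Lemma dot_slack_rhs x xi p : dot (slack_rhs x xi) p = affine_piece x p xi.
Proof.
have -> : slack_rhs x xi =
    (b0 - A0 *m x) + \sum_(i < m) xi i 0 *: (b i - A i *m x).
  rewrite /slack_rhs /rhs /techmx mulmxDl mulmx_suml opprD addrACA -sumrB.
  by congr (_ + _); apply: eq_bigr => i _; rewrite scalerBr scalemxAl.
rewrite dotDl addrC dotC [in RHS]/affine_piece; congr (_ + _); last exact: dotC.
rewrite (big_morph (dot p) (dotDr p) (dot0r p)).
apply: eq_bigr => i _; rewrite dotZr mulrC mxE; congr (_ * _).
by apply: eq_bigr => l _; rewrite !mxE mulrC.
Qed.

Lemma second_stageE x xi y : second_stage A0 A b0 b B x xi y <->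
  lev (slack_rhs x xi) (B *m y) /\ lev 0 y.
Proof.
have slackE i : slack_rhs x xi i 0 =
    rhs b0 b xi i 0 - (techmx A0 A xi *m x) i 0.
  by rewrite /slack_rhs mxE; congr (_ + _); rewrite mxE.
by split=> -[h y0]; split=> // i; have := h i;
  rewrite slackE [(_ *m x + _) i 0]mxE lerBlDl.
Qed.

(** Every [V] is vacuously a bound on the dual, so strong duality yields feasible
    points of arbitrarily small cost. *)
Lemma recourse_dual_infeasible x xi : second_stage A0 A b0 b B x xi !=set0 ->
  dual_polyhedron B z = set0 -> recourse A0 A b0 b B z x xi = -oo%E.
Proof.
move=> [y0 /second_stageE[uy0 y0_ge0]] P0; apply: eq_ninfty => V.
have [|y [uy y_ge0 zy]] := @strong_duality _ _ _ B z _ V _ uy0 y0_ge0.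
  by rewrite P0.
rewrite (le_trans (y := (dot z y)%:E)) ?lee_fin//.
by apply: ereal_inf_lbound; exists y => //; exact/second_stageE.
Qed.

Lemma recourse_extreme_points x xi p0 s :
  (forall p, extreme_points (dual_polyhedron B z) p <-> p \in p0 :: s) ->
  second_stage A0 A b0 b B x xi !=set0 ->
  recourse A0 A b0 b B z x xi =
    (seqmax (fun p => affine_piece x p xi) p0 s)%:E.
Proof.
move=> Es [y0 /second_stageE[uy0 y0_ge0]].
apply/le_anti/andP; split.
  have [|y [uy y_ge0 zy]] := @strong_duality _ _ _ B z _
      (seqmax (fun p => affine_piece x p xi) p0 s) _ uy0 y0_ge0.
    move=> p Pp.
    have [||e [/Es es pe]] := @dual_extreme_point_dominates
      (slack_rhs x xi) (dot z y0) p => //.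
      by move=> q; exact: weak_duality.
    rewrite (le_trans pe)// dot_slack_rhs.
    exact: (le_seqmax (fun p => affine_piece x p xi)).
  rewrite (le_trans (y := (dot z y)%:E)) ?lee_fin//.
  by apply: ereal_inf_lbound; exists y => //; exact/second_stageE.
apply: le_ereal_inf_tmp => _ [y /second_stageE[uy y_ge0] <-]; rewrite lee_fin.
have [p ps ->] := seqmax_attained (fun p => affine_piece x p xi) p0 s.
by have /Es[Pp _] := ps; rewrite -dot_slack_rhs; exact: weak_duality Pp.
Qed.

End recourse_function.

(** * Equivalence of the two programs *)

(** Infima may be taken in two stages, so equality of the partial minima is all
    that equivalence asks for. *)
Lemma equivalent_problems_partial_min (R : realType) (T Y : Type) (X : set T)
    (f : T -> \bar R) (D : set (T * Y)) (g : T * Y -> \bar R) :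
  (forall x, X x <-> exists y, D (x, y)) ->
  (forall x, X x -> f x = ereal_inf [set g (x, y) | y in [set y | D (x, y)]]) ->
  equivalent_problems X f D g.
Proof.
move=> XD fE; split.
  apply/le_anti/andP; split; apply: le_ereal_inf_tmp.
    move=> _ [[x y] Dxy <-]; have Xx : X x by apply/XD; exists y.
    apply: (@le_trans _ _ (f x)); first by apply: ereal_inf_lbound; exists x.
    by rewrite fE//; apply: ereal_inf_lbound; exists y.
  move=> _ [x Xx <-]; rewrite fE//; apply: le_ereal_inf_tmp => _ [y Dxy <-].
  by apply: ereal_inf_lbound; exists (x, y).
rewrite /argmin (_ : [set x | exists y, D (x, y)] = X); last first.
  by apply/seteqP; split=> x /XD.
rewrite -(eq_imagel fE).
by apply/seteqP; split=> x /= [Xx] fx; split=> //; rewrite -?fx fE// -fE.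
Qed.

Section programs.
Context {R : realType} {n m k N : nat}.
Variables (X : set 'cV[R]_n) (c : 'cV[R]_n).
Variables (A0 : 'M[R]_(k, n)) (A : 'I_m -> 'M[R]_(k, n)).
Variables (b0 : 'cV[R]_k) (b : 'I_m -> 'cV[R]_k).
Variables (B : 'M[R]_(k, m)) (z : 'cV[R]_m).
Variables (Xi : set 'cV[R]_m) (xihat : 'I_N -> 'cV[R]_m) (eps : R).
Hypotheses (mXi : measurable (Xi : set (borel_space R m))).
Hypotheses (Xi_unbounded : unbounded_in_every_direction Xi).
Hypotheses (N_gt0 : (0 < N)%N) (xihat_Xi : forall i, Xi (xihat i)).
Hypotheses (eps_gt0 : 0 < eps).
Hypotheses (rcr : relatively_complete_recourse A0 A b0 b B X Xi).

Let E := extreme_points (dual_polyhedron B z).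
Let g := @socp_objective R n N c eps.
Let D := socp_feasible A0 A b0 b B z xihat X.
Let f := dro_objective c A0 A b0 b B z xihat eps Xi.

Section feasible_dual.
Variables (p0 : 'cV[R]_k) (s : seq 'cV[R]_k).
Hypothesis Es : forall p, E p <-> p \in p0 :: s.
Variable x : 'cV[R]_n.
Hypothesis Xx : X x.

Let h (xi : 'cV[R]_m) := seqmax (fun p => affine_piece A0 A b0 b x p xi) p0 s.
Let L := seqmax (fun p => enorm (Cmx A b x *m p)) p0 s.

Lemma dro_objectiveE :
  f x = (dot c x + eps * L + average (h \o xihat))%:E.
Proof.
have [p ps Lp] := seqmax_attained (fun p => enorm (Cmx A b x *m p)) p0 s.
rewrite /f /dro_objective -addrA EFinD; congr (_ + _)%E.
have L_ge0 : 0 <= L by rewrite /L Lp enorm_ge0.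
have mh : measurable_fun [set: borel_space R m] (h : borel_space R m -> R).
  apply: measurable_seqmax => q.
  by apply: measurable_funD => //; exact: measurable_dot.
have h_lip u v : h u <= h v + L * enorm (u - v).
  have [q qs] := seqmax_attained (fun q => affine_piece A0 A b0 b x q u) p0 s.
  rewrite -/(h u) => ->.
  have hv : affine_piece A0 A b0 b x q v <= h v.
    exact: (le_seqmax (fun q => affine_piece A0 A b0 b x q v)).
  have qL : enorm (Cmx A b x *m q) <= L.
    exact: (le_seqmax (fun q => enorm (Cmx A b x *m q))).
  have := dot_le_enorm (Cmx A b x *m q) (u - v); rewrite dotBr.
  have := ler_wpM2r (enorm_ge0 (u - v)) qL.
  by move: hv; rewrite /affine_piece; lra.
have h_ge u : dot (Cmx A b x *m p) u + dot p (b0 - A0 *m x) <= h u.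
  exact: (le_seqmax (fun q => affine_piece A0 A b0 b x q u)).
rewrite -(sup_wasserstein_ball mXi N_gt0 xihat_Xi eps_gt0 L_ge0 mh h_lip
  (esym Lp) h_ge Xi_unbounded).
congr ereal_sup; apply: eq_imagel => F _; apply: eq_integral => xi.
rewrite inE => Xixi; apply: recourse_extreme_points => //.
exact: rcr.
Qed.

Lemma socp_feasible_seqmax : D (x, (L, \col_i h (xihat i))).
Proof.
split=> //= i p /Es ps; rewrite mxE; split.
  exact: (le_seqmax (fun q => affine_piece A0 A b0 b x q (xihat i))).
exact: (le_seqmax (fun q => enorm (Cmx A b x *m q))).
Qed.

(** For fixed [x] the constraints say exactly that [lambda >= L] and
    [s_i >= h xihat_i], and the objective increases with [lambda] and [s].  The
    bound on [lambda] is quantified over the samples too: there must be one. *)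
Lemma socp_partial_min :
  ereal_inf [set g (x, y) | y in [set y | D (x, y)]] =
  (dot c x + eps * L + average (h \o xihat))%:E.
Proof.
apply/le_anti/andP; split.
  apply: ereal_inf_lbound; exists (L, \col_i h (xihat i)).
    exact: socp_feasible_seqmax.
  rewrite /g /socp_objective /= mulrC; congr (_ + _ * _)%:E.
  by apply: eq_bigr => i _; rewrite mxE.
apply: le_ereal_inf_tmp => _ [[l t] [/= _ feas] <-]; rewrite lee_fin /=.
rewrite [l * _]mulrC lerD ?lerD2l//.
  rewrite /L ler_pM2l//; have [p ps ->] :=
    seqmax_attained (fun q => enorm (Cmx A b x *m q)) p0 s.
  by have /Es /(feas (Ordinal N_gt0))[] := ps.
apply: ler_average => i /=.
have [p ps] := seqmax_attained
  (fun q => affine_piece A0 A b0 b x q (xihat i)) p0 s.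
by rewrite -/(h _) => ->; have /Es /(feas i)[] := ps.
Qed.

End feasible_dual.

Section infeasible_dual.
Hypothesis P0 : dual_polyhedron B z = set0.
Variable x : 'cV[R]_n.
Hypothesis Xx : X x.

Lemma dro_objective_dual_infeasible : f x = -oo%E.
Proof.
rewrite /f /dro_objective; set S := [set _ | _ in _].
suff -> : ereal_sup S = -oo%E by [].
apply/eqP; rewrite -leeNy_eq; apply: ge_ereal_sup => _ [F [[FXi _] _] <-].
rewrite (eq_integral (cst -oo%E)); last first.
  move=> xi; rewrite inE => Xixi; apply: recourse_dual_infeasible => //.
  exact: rcr.
by rewrite integral_cst// [X in (_ * X)%E]FXi mule1.
Qed.

(** With no extreme point there is no constraint, and decreasing all [s_i]
    decreases the objective without bound. *)
Lemma socp_partial_min_dual_infeasible :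
  ereal_inf [set g (x, y) | y in [set y | D (x, y)]] = -oo%E.
Proof.
apply: eq_ninfty => r; pose t := r - dot c x.
apply: ereal_inf_lbound; exists (0, const_mx t) => /=.
  by split=> // i p [Pp _]; have : set0 p by rewrite -P0.
rewrite /g /socp_objective /= mul0r addr0.
have -> : N%:R^-1 * \sum_(i < N) (const_mx t : 'cV[R]_N) i 0 =
    average (fun _ : 'I_N => t).
  by congr (_ * _); apply: eq_bigr => i _; rewrite mxE.
by rewrite average_cst// /t addrC subrK.
Qed.

End infeasible_dual.

Lemma socp_feasibleP x : X x <-> exists y, D (x, y).
Proof.
split=> [Xx|[y []//]].
have [s Es] := finite_dual_extreme_points B z.
case: s Es => [|p0 s] Es.
  by exists (0, 0); split=> // i p /Es; rewrite in_nil.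
by eexists; exact: (socp_feasible_seqmax Es Xx).
Qed.

Lemma dro_objective_partial_min x : X x ->
  f x = ereal_inf [set g (x, y) | y in [set y | D (x, y)]].
Proof.
move=> Xx; have [s Es] := finite_dual_extreme_points B z.
case: s Es => [|p0 s] Es; last first.
  by rewrite (dro_objectiveE Es Xx) (socp_partial_min Es Xx).
have P0 : dual_polyhedron B z = set0.
  apply/seteqP; split=> // p Pp.
  have [|e [/Es]] := @dual_extreme_point_dominates _ _ _ B z 0 0 p _ Pp => //.
  by move=> q _; rewrite dotC dot0r.
by rewrite dro_objective_dual_infeasible// socp_partial_min_dual_infeasible.
Qed.

End programs.

Unset Implicit Arguments.
Set Strict Implicit.

Theorem corollary1 (R : realType) (n m k N : nat)
    (X : set 'cV[R]_n) (c : 'cV[R]_n)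
    (A0 : 'M[R]_(k, n)) (A : 'I_m -> 'M[R]_(k, n))
    (b0 : 'cV[R]_k) (b : 'I_m -> 'cV[R]_k)
    (B : 'M[R]_(k, m)) (z : 'cV[R]_m)
    (Xi : set 'cV[R]_m) (xihat : 'I_N -> 'cV[R]_m) (eps : R)
    (X_compact : compact X)
    (Xi_polish : polish_metric Xi)
    (Xi_unbounded : unbounded_in_every_direction Xi)
    (N_gt0 : (0 < N)%N)
    (xihat_Xi : forall i, Xi (xihat i))
    (eps_gt0 : 0 < eps)
    (rcr : relatively_complete_recourse A0 A b0 b B X Xi) :
  equivalent_problems X (dro_objective c A0 A b0 b B z xihat eps Xi)
    (socp_feasible A0 A b0 b B z xihat X) (@socp_objective R n N c eps).
Proof.
apply: equivalent_problems_partial_min => x; first exact: socp_feasibleP.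
apply: dro_objective_partial_min => //.
by apply: closed_borel; exact: polish_metric_closed.
Qed.
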